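(* Let $0<a\le b\le2$, let $\alpha:\mathbf{R}\to[a,b]$ be continuous, let $0<H<1$, $\lambda>0$, and let $X_{H,\alpha(x),\lambda}$ be the linear tempered fractional multistable motion. If $0<p<a$, then there exists a number $C_1$, depending only on $a,b,\lambda$ and $H$, such that for all $t,v\in\mathbf{R}$ with $|t-v|\ge1$, $$\mathbf{E}\Big[\big|X_{H,\alpha(x),\lambda}(t)-X_{H,\alpha(x),\lambda}(v)\big|^p\Big]\le C_1\Big(1+\frac{p}{a-p}\Big)|t-v|^{Hb}.$$
   Context: Conventions: $(x)_+=\max\{x,0\}$ and $0^\gamma=0$ for all $\gamma\in\mathbf{R}$. Set $$G_{H,\alpha(x),\lambda}(t,x)=e^{-\lambda(t-x)_+}(t-x)_+^{H-\frac1{\alpha(x)}}-e^{-\lambda(-x)_+}(-x)_+^{H-\frac1{\alpha(x)}} .$$ The multistable stochastic integral $I(f)=\int f(x)\,dM_\alpha(x)$, defined for measurable $f$ with $\int_{-\infty}^\infty|f(x)|^{\alpha(x)}dx<\infty$, is specified by its finite-dimensional distributions: $\mathbf{E}[e^{i\sum_{k=1}^d\theta_kI(f_k)}]=\exp\{-\int_{-\infty}^\infty|\sum_{k=1}^d\theta_kf_k(x)|^{\alpha(x)}dx\}$. The linear tempered fractional multistable motion (LTFmSM) is $X_{H,\alpha(x),\lambda}(t)=\int_{-\infty}^\infty G_{H,\alpha(x),\lambda}(t,x)\,dM_\alpha(x)$, $t\in\mathbf{R}$; thus $$\mathbf{E}\Big[e^{i\sum_{k=1}^d\theta_kX_{H,\alpha(x),\lambda}(t_k)}\Big]=\exp\Big\{-\int_{-\infty}^\infty\Big|\sum_{k=1}^d\theta_kG_{H,\alpha(x),\lambda}(t_k,x)\Big|^{\alpha(x)}dx\Big\}.$$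 *)

(* Defs.v *)
From HB Require Import structures.
From mathcomp Require Import all_boot all_order all_algebra.
From mathcomp Require Import all_classical all_reals all_analysis.
From mathcomp Require Import complex.

Set Implicit Arguments.
Unset Strict Implicit.
Unset Printing Implicit Defensive.

Import Order.TTheory GRing.Theory Num.Theory.
Import numFieldNormedType.Exports.

Local Open Scope classical_set_scope.
Local Open Scope ring_scope.

Definition pospart (R : realType) (x : R) : R := Num.max x 0.

(* [powR] satisfies [0 `^ 0 = 1]; here [0 ^ g = 0] for every real [g],
   including [g = 0] and [g < 0]. *)
Definition pow0 (R : realType) (x g : R) : R := if x == 0 then 0 else x `^ g.

Definition G_ltfmsm (R : realType) (H : R) (alpha : R -> R) (lambda t x : R)
  : R :=
  expR (- lambda * pospart (t - x)) * pow0 (pospart (t - x)) (H - (alpha x)^-1)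
  - expR (- lambda * pospart (- x)) * pow0 (pospart (- x)) (H - (alpha x)^-1).

Definition cis (R : realType) (x : R) : R[i] := Complex (cos x) (sin x).

(* The library's expectation is for (extended) real-valued functions. [fine]
   discards nothing when the real and imaginary parts are integrable, e.g. for
   the bounded random variables [cis \o Y]. *)
Definition expectationC (d : measure_display) (T : measurableType d)
    (R : realType) (P : probability T R) (Z : T -> R[i]) : R[i] :=
  Complex (fine 'E_P[fun w => complex.Re (Z w)]%E)
          (fine 'E_P[fun w => complex.Im (Z w)]%E).

Definition multistable_integrand (R : realType) (alpha f : R -> R) : Prop :=
  measurable_fun [set: R] f /\
  (\int[@lebesgue_measure R]_x (`|f x| `^ alpha x)%:E < +oo)%E.

(* [I f] stands for the integral of [f] against the alpha-multistable random
   measure: only its finite-dimensional distributions on the class of admissible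
   integrands are prescribed. The values of [I] outside that class are
   irrelevant. *)
Definition is_multistable_integral (d : measure_display)
    (T : measurableType d) (R : realType) (P : probability T R)
    (alpha : R -> R) (I : (R -> R) -> {RV P >-> R}) : Prop :=
  forall (n : nat) (theta : 'I_n -> R) (f : 'I_n -> R -> R),
    (forall k, multistable_integrand alpha (f k)) ->
    expectationC P (fun w => cis (\sum_(k < n) theta k * I (f k) w)) =
    real_complex R (expR (- \int[@lebesgue_measure R]_x
                            (`|\sum_(k < n) theta k * f k x| `^ alpha x))).

(* As for any stochastic integral, [X t] is determined up to a null set
   (depending on [t]). *)
Definition is_ltfmsm (d : measure_display) (T : measurableType d)
    (R : realType) (P : probability T R) (H : R) (alpha : R -> R) (lambda : R)
    (X : R -> {RV P >-> R}) : Prop :=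
  exists I : (R -> R) -> {RV P >-> R},
    is_multistable_integral alpha I /\
    forall t : R, {ae P, forall w, X t w = I (G_ltfmsm H alpha lambda t) w}.

(* Main.v *)
Require Import Defs.
From HB Require Import structures.
From mathcomp Require Import all_boot all_order all_algebra.
From mathcomp Require Import all_classical all_reals all_analysis.
From mathcomp Require Import measurable_realfun complex ring lra.
Import Order.TTheory GRing.Theory Num.Theory.
Import numFieldNormedType.Exports.
Local Open Scope classical_set_scope.
Local Open Scope ring_scope.

(** The kernels at times [t] and [v] share their second term, so the increment
    [X t - X v] is the integral of the difference of two one-sided kernels.
    With [u = t - x], the [alpha x]-th power of such a kernel is
    [exp (- lambda s u) u ^ (s H - 1)] for [s = alpha x] in [[a, 2]]. Splitting
    [0 < u <= 1] dyadically and [u > 1] into unit intervals dominates it by a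
    geometric series that depends only on [a], [H] and [lambda]. Hence
    [1 - E cos (theta (X t - X v)) <= C theta ^ a] for [0 < theta <= 1], uniformly
    in [t] and [v]. For [2 ^ k <= |y| < 2 ^ (k + 1)] one has
    [|y| ^ p <= 2 ^ ((k + 1) p) (1 - cos (2 ^ - k y)) / (1 - cos 1)], and summing
    over [k] bounds the [p]-th moment by a multiple of
    [1 / (1 - 2 ^ (p - a))], which is at most a constant times [a / (a - p)].
    The factor [|t - v| ^ (H b)] is at least [1]. *)

(** * Variable exponents, dyadic scales and domination by a geometric series *)

Lemma measurable_fun_powR2 {d} (T : measurableType d) {R : realType}
    (f g : T -> R) :
  measurable_fun setT f -> measurable_fun setT g ->
  measurable_fun setT (fun x => f x `^ g x).
Proof.
move=> mf mg; rewrite /powR; apply: measurable_fun_ifT.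
- by apply: measurable_fun_eqr.
- pose h (x : T) : R := if g x == 0 then 1 else 0.
  rewrite (_ : (fun t => _) = h); last first.
    by apply/funext => x; rewrite /h; case: (g x == 0).
  apply: measurable_fun_ifT => //; exact: measurable_fun_eqr.
- apply: measurableT_comp => //; apply: measurable_funM => //.
  exact: measurableT_comp (@measurable_ln R) mf.
Qed.

Lemma dyadic_scale {R : realType} (y : R) :
  1 <= y -> exists k : nat, 2 ^+ k <= y < 2 ^+ k.+1.
Proof.
move=> y1.
have ex : exists n : nat, y < 2 ^+ n.
  exists (Num.bound y).
  apply: lt_le_trans (archi_boundP (le_trans ler01 y1)) _.
  by rewrite -natrX ler_nat ltnW// ltn_expl.
case: (ex_minnP ex) => -[|n] hn min_n.
  by rewrite expr0 ltNge y1 in hn.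
exists n; rewrite hn andbT leNgt; apply/negP => /min_n.
by rewrite ltnn.
Qed.

(** The whole series of the nonnegative [h k] dominates [f], since at each point one term already
    does. Exchanging sum and integral leaves a geometric series. It serves both the kernel integral
    and the moment. *)
Lemma ge0_integral_le_geometric {d} (T : measurableType d) {R : realType}
    (mu : {measure set T -> \bar R}) (f : T -> R) (h : nat -> T -> R)
    (C q : R) :
  0 <= C -> 0 < q < 1 ->
  measurable_fun setT f -> (forall x, 0 <= f x) ->
  (forall k, measurable_fun setT (h k)) -> (forall k x, 0 <= h k x) ->
  (forall x, exists k, f x <= h k x) ->
  (forall k, (\int[mu]_x (h k x)%:E <= (C * q ^+ k)%:E)%E) ->
  (\int[mu]_x (f x)%:E <= (C / (1 - q))%:E)%E.
Proof.
move=> C0 /andP[q0 q1] mf f0 mh h0 fh hC.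
have mhE k : measurable_fun setT (EFin \o h k) by exact/measurable_EFinP.
have h0E k x : (0 <= (h k x)%:E)%E by rewrite lee_fin.
apply: (@le_trans _ _ (\int[mu]_x (\sum_(0 <= k <oo) (h k x)%:E))%E).
  apply: ge0_le_integral => //.
  - by move=> x _; rewrite lee_fin.
  - exact/measurable_EFinP.
  - apply: (@ge0_emeasurable_sum _ _ _ _ (fun k x => (h k x)%:E) xpredT).
      by move=> k x _ _; exact: h0E.
    by move=> k _; exact: mhE.
  - move=> x _; have [k fk] := fh x.
    apply: le_trans (@nneseries_lim_ge _ _ predT 0%N k.+1 _) => //.
    rewrite big_nat_recr//= -[leLHS]add0e; apply: leeD; last by rewrite lee_fin.
    by apply: sume_ge0.
rewrite integral_nneseries//.
apply: lime_le.
  by apply: is_cvg_nneseries => n _ _; apply: integral_ge0.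
apply: nearW => n.
apply: (@le_trans _ _ (\sum_(0 <= k < n) (C * q ^+ k)%:E)%E).
  by apply: lee_sum => i _; exact: hC.
rewrite sumEFin lee_fin.
by apply: geometric_le_lim => //; rewrite ger0_norm ?ltW.
Qed.

(** * The one-sided kernel: pointwise bounds and a uniform integral bound *)

Definition tkernel {R : realType} (H : R) (alpha : R -> R) (lambda t x : R) : R :=
  expR (- lambda * pospart (t - x)) * pow0 (pospart (t - x)) (H - (alpha x)^-1).

Lemma measurable_tkernel {R : realType} (H : R) (alpha : R -> R)
    (lambda t : R) :
  continuous alpha -> (forall x, alpha x != 0) ->
  measurable_fun setT (tkernel H alpha lambda t).
Proof.
move=> ca a0.
have mu : measurable_fun setT (fun x : R => pospart (t - x)).
  apply: measurable_maxr => //; exact: measurable_funB.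
apply: measurable_funM.
  by apply: measurableT_comp => //; apply: measurable_funM.
apply: measurable_fun_ifT => //; first exact: measurable_fun_eqr.
apply: measurable_fun_powR2 => //; apply: measurable_funB => //.
apply: continuous_measurable_fun => x.
by apply: cvgV; [exact: a0|exact: ca].
Qed.

Lemma tkernel_le0 {R : realType} (H : R) alpha (lambda t x : R) :
  t <= x -> tkernel H alpha lambda t x = 0.
Proof.
by move=> tx; rewrite /tkernel /pow0 /pospart (max_idPr _) ?eqxx ?mulr0// subr_le0.
Qed.

(** The exponent is [(H - 1 / s) * s = s * H - 1]. Splitting off the division by [t - x] leaves the
    positive exponent [s * H], so that monotonicity of powers applies. *)
Lemma tkernel_powR {R : realType} (H : R) alpha (lambda t x : R) :
  x < t -> 0 < alpha x ->
  `|tkernel H alpha lambda t x| `^ alpha x =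
  expR (- (lambda * alpha x * (t - x))) * (t - x) `^ (alpha x * H) / (t - x).
Proof.
move=> xt a0; have u0 : 0 < t - x by rewrite subr_gt0.
rewrite /tkernel /pow0 /pospart (max_idPl _) ?ltW// gt_eqF//.
rewrite ger0_norm ?mulr_ge0 ?expR_ge0 ?powR_ge0//.
rewrite powRM ?expR_ge0 ?powR_ge0// -powRrM -expRM -mulrA; congr (_ * _).
  by congr expR; ring.
rewrite mulrBl mulVf ?gt_eqF// powRD ?(gt_eqF u0) ?implybT//.
by rewrite powRN powRr1 ?ltW// (mulrC H).
Qed.

(** The exponential is at most 1, [u <= 1] lets [s * H] be lowered to [a * H], and
    [1 / u <= 2 * 2 ^ k]. The growing factor [2 ^ k] is later cancelled by the length of the
    interval. *)
Lemma tkernel_near_bound {R : realType} (a s H lambda u : R) (k : nat) :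
  0 < H -> 0 < lambda -> 0 < a -> a <= s ->
  2 ^- k.+1 <= u <= 2 ^- k ->
  expR (- (lambda * s * u)) * u `^ (s * H) / u
    <= 2 * (2 `^ (- (a * H))) ^+ k * 2 ^+ k.
Proof.
move=> H0 l0 a0 as_ /andP[ku uk].
have u0 : 0 < u by apply: lt_le_trans ku; rewrite invr_gt0 exprn_gt0.
have s0 : 0 < s by exact: lt_le_trans as_.
have u1 : u <= 1 by rewrite (le_trans uk)// invf_le1 ?exprn_gt0// exprn_ege1// ler1n.
have -> : 2 * 2 `^ (- (a * H)) ^+ k * 2 ^+ k =
          1 * 2 `^ (- (a * H)) ^+ k * 2 ^+ k.+1 :> R by rewrite exprS; ring.
have ui0 : 0 <= u^-1 by rewrite invr_ge0 ltW.
apply: ler_pM; rewrite ?mulr_ge0 ?expR_ge0 ?powR_ge0//; last first.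
  by rewrite -[leRHS]invrK lef_pV2 ?posrE ?invr_gt0 ?exprn_gt0.
apply: ler_pM; rewrite ?expR_ge0 ?powR_ge0//.
  by rewrite -expR0 ler_expR oppr_le0 !mulr_ge0// ltW.
apply: (@le_trans _ _ (u `^ (a * H))).
  by apply: ger_powR; rewrite ?u0// ler_pM2r.
have -> : 2 `^ (- (a * H)) ^+ k = (2 ^- k) `^ (a * H) :> R.
  rewrite powRN -powR_inv1 ?powR_ge0// -powR_mulrn ?powR_ge0// -!powRrM.
  rewrite -powR_inv1 ?exprn_ge0// -powR_mulrn// -!powRrM; congr powR; ring.
apply: ge0_ler_powR; rewrite ?nnegrE ?invr_ge0 ?exprn_ge0//; first by rewrite mulr_ge0 ?ltW.
exact: ltW.
Qed.

(** As [s * H <= 2] and [u >= 1], the power divided by [u] is at most [u]. With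
    [c = lambda * a / 2], one half of the exponential absorbs [u] through [c * u <= expR (c * u)];
    the other half decays geometrically. *)
Lemma tkernel_far_bound {R : realType} (a s H lambda u : R) (k : nat) :
  0 < H -> H < 1 -> 0 < lambda -> 0 < a -> a <= s <= 2 ->
  k.+1%:R <= u ->
  expR (- (lambda * s * u)) * u `^ (s * H) / u
    <= 2 / (lambda * a) * expR (- (lambda * a / 2)) ^+ k.
Proof.
move=> H0 H1 l0 a0 /andP[as_ s2] ku.
have u1 : 1 <= u by apply: le_trans ku; rewrite ler1n.
have u0 : 0 < u by exact: lt_le_trans u1.
have s0 : 0 < s by exact: lt_le_trans as_.
have c0 : 0 < lambda * a / 2 by rewrite divr_gt0 ?mulr_gt0.
apply: (@le_trans _ _ (u * expR (- (lambda * a * u)))).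
  rewrite ler_pdivrMr// (_ : u * _ * u = expR (- (lambda * a * u)) * u ^+ 2); last by ring.
  apply: ler_pM; rewrite ?expR_ge0 ?powR_ge0//.
    by rewrite ler_expR lerN2 ler_pM2r// ler_pM2l.
  rewrite -powR_mulrn ?(ltW u0)//; apply: ler_powR => //.
  by rewrite -[leRHS]mulr1; apply: ler_pM; rewrite ?(ltW s0) ?(ltW H0) ?(ltW H1).
rewrite (_ : 2 / _ = (lambda * a / 2)^-1); last by rewrite [RHS]invfM invrK mulrC.
set c := lambda * a / 2 in c0 *.
have -> : - (lambda * a * u) = - (c * u) + - (c * u) by rewrite /c; field.
rewrite expRD mulrA; apply: ler_pM; rewrite ?mulr_ge0 ?expR_ge0 ?(ltW u0)//.
  rewrite expRN ler_pdivrMr ?expR_gt0// mulrC ler_pdivlMr// mulrC.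
  by apply: le_trans (expR_ge1Dx _); rewrite lerDr.
rewrite -expRM_natl ler_expR mulrN lerN2 mulrC ler_pM2l//.
by apply: le_trans ku; rewrite ler_nat.
Qed.

Lemma integral_cst_itv {R : realType} (c y z : R) : 0 <= c -> y <= z ->
  (\int[@lebesgue_measure R]_x (c * \1_`[y, z]%classic x)%:E
   = (c * (z - y))%:E)%E.
Proof.
move=> c0 yz; under eq_integral do rewrite EFinM.
rewrite ge0_integralZl//; last by apply/measurable_EFinP; exact: measurable_indic.
rewrite integral_indic// setIT EFinM; congr (_ * _)%E.
have := lebesgue_measure_itv `[y, z]; rewrite /= lte_fin => ->.
case: ltP => // zy.
by rewrite (le_anti (introT andP (conj yz zy))) subrr.
Qed.

(** [K] is fixed before [alpha] and [t]; this is the source of the uniformity of the final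
    constant. *)
Lemma integral_tkernel_bound {R : realType} (a H lambda : R) :
  0 < H -> H < 1 -> 0 < lambda -> 0 < a ->
  exists2 K : R, 0 <= K & forall (alpha : R -> R) (t : R),
    continuous alpha -> (forall x, a <= alpha x <= 2) ->
    (\int[@lebesgue_measure R]_x
       (`|tkernel H alpha lambda t x| `^ alpha x)%:E <= K%:E)%E.
Proof.
move=> H0 H1 l0 a0.
(* [r] is the ratio of the pieces near [t], [e] that of the far ones; [q] dominates both. *)
pose r : R := 2 `^ (- (a * H)); pose e := expR (- (lambda * a / 2)).
pose C := 2 / (lambda * a); pose q := Num.max r e.
have r0 : 0 < r by rewrite powR_gt0.
have e0 : 0 < e by rewrite expR_gt0.
have r1 : r < 1.
  rewrite /r powRN invf_lt1 ?powR_gt0// /powR pnatr_eq0/= expR_gt1.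
  by rewrite mulr_gt0 ?mulr_gt0// ln_gt0 ?ltr1n.
have e1 : e < 1 by rewrite /e expR_lt1 oppr_lt0 divr_gt0 ?mulr_gt0.
have q0 : 0 < q by rewrite lt_max r0.
have q1 : q < 1 by rewrite gt_max r1 e1.
have C0 : 0 < C by rewrite divr_gt0 ?mulr_gt0.
exists ((2 + C) / (1 - q)).
  by rewrite divr_ge0 ?subr_ge0 ?(ltW q1)// addr_ge0// ltW.
move=> alpha t ca hal.
have al0 x : 0 < alpha x by have /andP[h _] := hal x; exact: lt_le_trans h.
(* [h1 k] dominates where [2 ^ - k.+1 <= t - x <= 2 ^ - k], [h2 k] where
   [k.+1 <= t - x <= k.+2]. *)
pose h1 (k : nat) (x : R) : R := 2 * r ^+ k * 2 ^+ k * \1_`[t - 2 ^- k, t]%classic x.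
pose h2 (k : nat) (x : R) : R := C * e ^+ k * \1_`[t - k.+2%:R, t - k.+1%:R]%classic x.
have c10 k : 0 <= 2 * r ^+ k * 2 ^+ k by rewrite !mulr_ge0 ?exprn_ge0 ?(ltW r0).
have c20 k : 0 <= C * e ^+ k by rewrite mulr_ge0 ?exprn_ge0 ?(ltW e0) ?(ltW C0).
have h10 k x : 0 <= h1 k x by rewrite /h1 mulr_ge0// indicE ler0n.
have h20 k x : 0 <= h2 k x by rewrite /h2 mulr_ge0// indicE ler0n.
have mh1 k : measurable_fun setT (h1 k).
  by apply: measurable_funM => //; exact: measurable_indic.
have mh2 k : measurable_fun setT (h2 k).
  by apply: measurable_funM => //; exact: measurable_indic.
apply: (@ge0_integral_le_geometric _ _ R (@lebesgue_measure R) _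
  (fun k x => h1 k x + h2 k x) (2 + C) q).
- by rewrite addr_ge0// ltW.
- by rewrite q0.
- apply: measurable_fun_powR2; last exact: continuous_measurable_fun.
  apply: measurableT_comp => //; apply: measurable_tkernel => // x.
  by rewrite gt_eqF.
- by move=> x; rewrite powR_ge0.
- by move=> k; exact: (measurable_funD (mh1 k) (mh2 k)).
- by move=> k x; apply: addr_ge0.
- move=> x; have [tx|xt] := leP t x.
    (* Here the kernel vanishes, and its power is 0 because [alpha x] is nonzero. *)
    by exists 0%N; rewrite tkernel_le0 ?normr0 ?powR0 ?addr_ge0 ?gt_eqF.
  rewrite tkernel_powR//.
  have u0 : 0 < t - x by rewrite subr_gt0.
  have /andP[ax x2] := hal x.
  have [u1|u1] := leP (t - x) 1.
    have [|k /andP[k1 k2]] := @dyadic_scale R (t - x)^-1.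
      by rewrite invf_ge1.
    have uk : t - x <= 2 ^- k.
      by rewrite -[leLHS]invrK lef_pV2 ?posrE ?invr_gt0 ?exprn_gt0.
    exists k; apply: (@le_trans _ _ (h1 k x)); last by rewrite lerDl.
    rewrite /h1 indicE mem_set ?mulr1/=; last first.
      by rewrite in_itv/= (ltW xt) andbT lerBlDr -lerBlDl.
    apply: tkernel_near_bound => //; rewrite uk andbT.
    by rewrite -[leRHS]invrK lef_pV2 ?posrE ?invr_gt0 ?exprn_gt0// ltW.
  (* With [m] the integer part of [t - x > 1], the index is [m.-1], because [h2 0] starts at
     distance 1 from [t]. *)
  have /andP[] := truncn_itv (ltW u0); set m := Num.trunc _ => m1 m2.
  have m0 : (0 < m)%N by rewrite -ltnS -(ltr_nat R) (lt_trans u1).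
  exists m.-1; apply: (@le_trans _ _ (h2 m.-1 x)); last by rewrite lerDr.
  rewrite /h2 prednK// indicE mem_set ?mulr1/=; last first.
    by rewrite in_itv/= lerBlDr -lerBlDl (ltW m2) lerBrDr -lerBrDl.
  by apply: tkernel_far_bound => //; rewrite ?ax// prednK.
- move=> k; under eq_integral do rewrite EFinD.
  rewrite ge0_integralD//.
  2: by move=> x _; rewrite lee_fin.
  2: by apply/measurable_EFinP; exact: mh1.
  2: by move=> x _; rewrite lee_fin.
  2: by apply/measurable_EFinP; exact: mh2.
  rewrite !integral_cst_itv//.
  + rewrite -EFinD lee_fin [leRHS]mulrDl; apply: lerD.
      rewrite opprB addrC subrK mulfK ?gt_eqF ?exprn_gt0//.
      by rewrite ler_pM2l// lerXn2r ?nnegrE ?(ltW r0) ?(ltW q0)// le_max lexx.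
    rewrite (_ : _ - _ - _ = 1); last by rewrite -[k.+2%:R]natr1; ring.
    rewrite mulr1 ler_pM2l//.
    by rewrite lerXn2r ?nnegrE ?(ltW e0) ?(ltW q0)// le_max lexx orbT.
  + by rewrite lerB// ler_nat.
  + by rewrite lerBlDr lerDl.
Qed.

(** * From bounds on [1 - cos] near frequency 0 to moments *)

(** The hypothesis at [theta = 2 ^ - k] controls the scale where [|Y|] is about [2 ^ k]. That scale
    contributes a multiple of [2 ^ (k p) * 2 ^ (- k a)], a geometric sequence since [p < a]. *)
Lemma powR_moment_le {d} (T : measurableType d) {R : realType}
    (P : probability T R) (Y : T -> R) (a p C : R) :
  measurable_fun setT Y -> 0 < p < a -> a <= 2 -> 0 <= C ->
  (forall theta : R, 0 < theta <= 1 ->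
     (\int[P]_w (1 - cos (theta * Y w))%:E <= (C * theta `^ a)%:E)%E) ->
  (\int[P]_w (`|Y w| `^ p)%:E
   <= ((1 + 4 / (1 - cos 1) * C) * (1 + (a * ln 2)^-1)
       * (1 + p / (a - p)))%:E)%E.
Proof.
move=> mY /andP[p0 pa] a2 C0 hC.
have a0 : 0 < a by exact: lt_trans pa.
have s0 : 0 < a - p by rewrite subr_gt0.
have cos11 : 0 < 1 - cos 1 :> R.
  have p2 := @pi_ge2 R.
  rewrite subr_gt0 -[ltRHS]cos0 ltr_cos// in_itv/= ?lexx ?ler01 ?pi_ge0//.
  by rewrite (le_trans _ p2)// ler1n.
have ln20 : 0 < ln 2 :> R by rewrite ln_gt0 ?ltr1n.
pose D : R := (1 - cos 1)^-1.
have D0 : 0 <= D by rewrite invr_ge0 ltW.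
pose q : R := 2 `^ (p - a).
have q0 : 0 < q by rewrite powR_gt0.
have qE : q = expR (- ((a - p) * ln 2)).
  by rewrite /q /powR pnatr_eq0/= -mulNr opprB.
have q1 : q < 1 by rewrite qE expR_lt1 oppr_lt0 mulr_gt0.
(* With [q = expR (- x)], this is [1 + x <= expR x] rearranged. *)
have q1V : (1 - q)^-1 <= 1 + ((a - p) * ln 2)^-1.
  set x := (a - p) * ln 2 in qE *.
  have x0 : 0 < x by rewrite mulr_gt0.
  rewrite -[leRHS]invrK lef_pV2 ?posrE ?subr_gt0 ?invr_gt0 ?addr_gt0 ?invr_gt0//.
  rewrite lerBrDl -lerBrDr qE expRN.
  have -> : 1 - (1 + x^-1)^-1 = (1 + x)^-1 by field; lra.
  by rewrite lef_pV2 ?posrE ?expR_gt0 ?addr_gt0// expR_ge1Dx.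
(* The summand [q ^+ k] equals 1 at [k = 0] and so covers [|Y w| <= 1]; the second summand covers
   the dyadic scale [k]. *)
pose h (k : nat) (w : T) : R :=
  q ^+ k + D * (2 ^+ k.+1) `^ p * (1 - cos (2 ^- k * Y w)).
have mcos k : measurable_fun setT (fun w => 1 - cos (2 ^- k * Y w)).
  apply: measurable_funB => //; apply: measurableT_comp.
    exact: continuous_measurable_fun (@continuous_cos R).
  exact: measurable_funM.
have cos0' k w : 0 <= 1 - cos (2 ^- k * Y w) by rewrite subr_ge0 cos_le1.
have c0 k : 0 <= D * (2 ^+ k.+1) `^ p by rewrite mulr_ge0 ?powR_ge0.
apply: (@le_trans _ _ ((1 + 4 * D * C) / (1 - q))%:E); last first.
  have M0 : 0 <= 1 + 4 * D * C by rewrite addr_ge0// !mulr_ge0.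
  rewrite lee_fin -[leRHS]mulrA; apply: ler_pM => //; first by rewrite invr_ge0 subr_ge0 ltW.
  apply: (le_trans q1V).
  (* Uses [1 + p / (a - p) = a / (a - p)]. *)
  rewrite (_ : _ * (1 + p / (a - p)) = 1 + p / (a - p) + ((a - p) * ln 2)^-1); last first.
    by field; rewrite !gt_eqF.
  by rewrite lerD2r lerDl divr_ge0 ?ltW.
apply: (@ge0_integral_le_geometric _ _ R P _ h).
- by rewrite addr_ge0// !mulr_ge0.
- by rewrite q0.
- by apply: measurable_fun_powR2 => //; exact: measurableT_comp.
- by move=> x; exact: powR_ge0.
- by move=> k; apply: measurable_funD => //; exact: measurable_funM.
- by move=> k x; rewrite addr_ge0 ?exprn_ge0 ?mulr_ge0 ?powR_ge0 ?(ltW q0) ?cos0'.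
- move=> w; have [y1|y1] := leP `|Y w| 1.
    exists 0%N; rewrite /h expr0 (@le_trans _ _ 1)//; last first.
      by rewrite lerDl mulr_ge0.
    have -> : 1 = 1 `^ p :> R by rewrite powR1.
    by rewrite ge0_ler_powR ?nnegrE ?(ltW p0).
  have [k /andP[k1 k2]] := dyadic_scale _ (ltW y1).
  exists k; apply: (@le_trans _ _ (D * (2 ^+ k.+1) `^ p * (1 - cos (2 ^- k * Y w)))).
    rewrite mulrAC mulrC -[leLHS]mulr1; apply: ler_pM; rewrite ?powR_ge0//.
      by rewrite ge0_ler_powR ?nnegrE ?(ltW p0) ?exprn_ge0 ?(ltW k2).
    rewrite /D mulrC ler_pdivlMr// mul1r lerB//.
    (* [cos] is even and decreasing on [[0, pi]], which contains [[1, 2]], so its value here is at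
       most [cos 1]. *)
    have -> : cos (2 ^- k * Y w) = cos (2 ^- k * `|Y w|).
      by case: (ger0P (Y w)) => // _; rewrite mulrN cosN.
    have k3 : 1 <= 2 ^- k * `|Y w| by rewrite mulrC ler_pdivlMr ?exprn_gt0// mul1r.
    have k4 : 2 ^- k * `|Y w| <= 2.
      by rewrite mulrC ler_pdivrMr ?exprn_gt0// -exprS ltW.
    have p2 := @pi_ge2 R.
    move: k3 k4; set z := 2 ^- k * `|Y w|.
    rewrite le_eqVlt => /predU1P[<-//|k3 k4]; apply: ltW.
    by rewrite ltr_cos// in_itv/=; apply/andP; split; lra.
  by rewrite lerDr exprn_ge0// ltW.
- move=> k; under eq_integral do rewrite EFinD.
  rewrite ge0_integralD//.
  2: by move=> x _; rewrite lee_fin exprn_ge0// ltW.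
  2: by move=> x _; rewrite lee_fin mulr_ge0.
  2: by apply/measurable_EFinP; exact: measurable_funM.
  under [X in (_ + X)%E]eq_integral do rewrite EFinM.
  rewrite integral_cst// [X in (_ * X + _)%E](_ : _ = 1%E); last exact: probability_setT.
  rewrite mule1 ge0_integralZl//.
  2: by apply/measurable_EFinP; exact: mcos.
  2: by rewrite lee_fin.
  rewrite mulrDl EFinD mul1r leeD2l//.
  apply: (@le_trans _ _ ((D * (2 ^+ k.+1) `^ p)%:E * (C * (2 ^- k) `^ a)%:E)%E).
    rewrite lee_wpmul2l ?lee_fin//; apply: hC.
    by rewrite invr_gt0 exprn_gt0//= invf_le1 ?exprn_gt0// exprn_ege1// ler1n.
  rewrite -EFinM lee_fin.
  have -> : q ^+ k = (2 ^+ k) `^ p * (2 ^- k) `^ a.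
    rewrite /q -powR_mulrn ?powR_ge0// -powRrM.
    rewrite -(powR_inv1 (exprn_ge0 k (ler0n R 2))) -!powR_mulrn// -!powRrM -powRD.
      by congr powR; ring.
    by rewrite pnatr_eq0 implybT.
  rewrite exprS powRM ?exprn_ge0//.
  (* The 4 in the constant pays for [2 ^ k.+1] in place of [2 ^ k], as [p < a <= 2]. *)
  have h2p : 2 `^ p <= 4 :> R.
    rewrite (_ : 4 = 2 `^ 2%:R); last by rewrite powR_mulrn//; ring.
    by apply: ler_powR; rewrite ?ler1n// (le_trans (ltW pa)).
  set A := (2 ^+ k) `^ p; set B := (2 ^- k) `^ a.
  rewrite (_ : _ * (C * B) = 2 `^ p * (D * A * C * B)); last by ring.
  rewrite (_ : 4 * D * C * _ = 4 * (D * A * C * B)); last by ring.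
  by rewrite ler_wpM2r// !mulr_ge0// powR_ge0.
Qed.

(** * The increment kernel and the characteristic function of the increment *)

(** [|x - y|] is at most twice the larger modulus, and [2 ^ s <= 4]. This treats exponents below and
    above 1 alike. *)
Lemma normB_powR_le {R : realType} (s x y : R) : 0 < s -> s <= 2 ->
  `|x - y| `^ s <= 4 * (`|x| `^ s + `|y| `^ s).
Proof.
move=> s0 s2.
wlog xy : x y / `|x| <= `|y|.
  move=> W; case: (leP `|x| `|y|) => [/W//|/ltW /W].
  by rewrite distrC [X in _ -> _ <= _ * X]addrC.
apply: (@le_trans _ _ ((2 * `|y|) `^ s)).
  rewrite ge0_ler_powR ?nnegrE ?(ltW s0) ?mulr_ge0//.
  by apply: le_trans (ler_normB _ _) _; rewrite mulr2n mulrDl mul1r lerD2r.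
rewrite powRM//; apply: ler_pM; rewrite ?powR_ge0//; last by rewrite lerDr powR_ge0.
rewrite (_ : 4 = 2 `^ 2%:R); last by rewrite powR_mulrn//; ring.
by apply: ler_powR; rewrite ?ler1n.
Qed.

Lemma G_ltfmsmE {R : realType} (H : R) (alpha : R -> R) (lambda t : R) :
  G_ltfmsm H alpha lambda t =
  fun x => tkernel H alpha lambda t x - tkernel H alpha lambda 0 x.
Proof. by apply/funext => x; rewrite /tkernel sub0r. Qed.

(** Serves twice: [v = 0] makes [G_ltfmsm] an admissible integrand, and general [v] bounds the
    kernel of the increment. *)
Lemma tkernelB_integrand {R : realType} (a K H : R) (alpha : R -> R)
    (lambda t v : R) :
  continuous alpha -> 0 < a -> (forall x, a <= alpha x <= 2) ->
  (forall s, (\int[@lebesgue_measure R]_x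
     (`|tkernel H alpha lambda s x| `^ alpha x)%:E <= K%:E)%E) ->
  let f x := tkernel H alpha lambda t x - tkernel H alpha lambda v x in
  measurable_fun setT f /\
  (\int[@lebesgue_measure R]_x (`|f x| `^ alpha x)%:E <= (4 * (K + K))%:E)%E.
Proof.
move=> ca a0 hal hK f.
have al0 x : 0 < alpha x by have /andP[h _] := hal x; exact: lt_le_trans h.
have mal : measurable_fun setT alpha by exact: continuous_measurable_fun.
have mk s : measurable_fun setT (tkernel H alpha lambda s).
  by apply: measurable_tkernel => // x; rewrite gt_eqF.
have mf : measurable_fun setT f by exact: measurable_funB.
split=> //.
have mka s : measurable_fun setT (fun x => `|tkernel H alpha lambda s x| `^ alpha x).
  by apply: measurable_fun_powR2 => //; exact: measurableT_comp.
apply: (@le_trans _ _ (\int[@lebesgue_measure R]_x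
   (4%:E * ((`|tkernel H alpha lambda t x| `^ alpha x)%:E
     + (`|tkernel H alpha lambda v x| `^ alpha x)%:E)))%E).
  apply: ge0_le_integral => //.
  - apply/measurable_EFinP; apply: measurable_fun_powR2 => //.
    exact: measurableT_comp.
  - apply/measurable_EFinP; apply: measurable_funM => //.
    exact: (measurable_funD (mka t) (mka v)).
  - move=> x _; rewrite -EFinD -EFinM lee_fin; apply: normB_powR_le => //.
    by have /andP[] := hal x.
rewrite ge0_integralZl//.
2: by apply/measurable_EFinP; exact: (measurable_funD (mka t) (mka v)).
2: by move=> x _; rewrite -EFinD lee_fin addr_ge0 ?powR_ge0.
rewrite EFinM lee_wpmul2l//.
rewrite ge0_integralD//.
2: by apply/measurable_EFinP; exact: mka.
2: by apply/measurable_EFinP; exact: mka.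
by rewrite EFinD leeD.
Qed.

(** [I] is not known to be linear, so the difference is reached through the joint law with
    coefficients [theta] and [- theta]. The real part gives mean cosine [expR (- J)]; [theta <= 1]
    and [a <= alpha x] give [J <= K * theta ^ a], and [1 - expR (- J) <= J]. *)
Lemma multistable_integral_cos_le {d} (T : measurableType d) {R : realType}
    (P : probability T R) (alpha : R -> R) (I : (R -> R) -> {RV P >-> R})
    (f g : R -> R) (a K theta : R) :
  is_multistable_integral alpha I ->
  measurable_fun setT alpha -> (forall x, a <= alpha x) ->
  multistable_integrand alpha f -> multistable_integrand alpha g ->
  (\int[@lebesgue_measure R]_x (`|f x - g x| `^ alpha x)%:E <= K%:E)%E ->
  0 < theta <= 1 ->
  (\int[P]_w (1 - cos (theta * (I f w - I g w)))%:E
   <= (K * theta `^ a)%:E)%E.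
Proof.
move=> hI mal aal hf hg hK /andP[th0 th1].
pose F (i : 'I_2) := if i == ord0 then f else g.
pose th (i : 'I_2) := if i == ord0 then theta else - theta.
have hF i : multistable_integrand alpha (F i) by rewrite /F; case: ifP.
have /(congr1 (@complex.Re R)) := hI 2%N th F hF.
rewrite /expectationC /= unlock.
set J := (\int[_]_x _)%R.
have [mf _] := hf; have [mg _] := hg.
have mfg : measurable_fun setT (fun x => `|f x - g x| `^ alpha x).
  apply: measurable_fun_powR2 => //; apply: measurableT_comp => //.
  exact: measurable_funB.
have JK : J <= K * theta `^ a.
  have JE : (\int[@lebesgue_measure R]_x
      (`|\sum_(k < 2) th k * F k x| `^ alpha x)%:E
      <= (K * theta `^ a)%:E)%E.
    apply: (@le_trans _ _ (\int[@lebesgue_measure R]_x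
        ((theta `^ a)%:E * (`|f x - g x| `^ alpha x)%:E))%E); last first.
      rewrite ge0_integralZl ?lee_fin ?powR_ge0//.
      2: by apply/measurable_EFinP.
      by rewrite mulrC EFinM lee_wpmul2l// lee_fin powR_ge0.
    have sE x : \sum_(k < 2) th k * F k x = theta * (f x - g x).
      by rewrite !big_ord_recl big_ord0 /= /th /F /=; ring.
    apply: ge0_le_integral => //.
    - apply/measurable_EFinP; apply: measurable_fun_powR2 => //.
      under eq_fun do rewrite sE.
      apply: measurableT_comp => //; apply: measurable_funM => //.
      exact: measurable_funB.
    - apply/measurable_EFinP; exact: measurable_funM.
    - move=> x _; rewrite -EFinM lee_fin sE normrM gtr0_norm// powRM ?(ltW th0)//.
      by rewrite ler_wpM2r ?powR_ge0// ger_powR// th0.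
  (* [J] is [fine] of the extended integral, which [JE] shows to be finite. *)
  rewrite /J /Rintegral -lee_fin fineK// ge0_fin_numE ?(le_lt_trans JE) ?ltry//.
  by apply: integral_ge0 => x _; rewrite lee_fin powR_ge0.
have sIE w : \sum_(k < 2) th k * I (F k) w = theta * (I f w - I g w).
  by rewrite !big_ord_recl big_ord0 /= /th /F /=; ring.
under eq_integral do rewrite sIE.
have mc : measurable_fun setT (fun w => cos (theta * (I f w - I g w))).
  apply: measurableT_comp.
    exact: continuous_measurable_fun (@continuous_cos R).
  by apply: measurable_funM => //; exact: measurable_funB.
have ic : P.-integrable setT (EFin \o (fun w => cos (theta * (I f w - I g w)))).
  apply: (le_integrable measurableT _ _ (finite_measure_integrable_cst P 1 measurableT)).
    exact/measurable_EFinP.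
  by move=> w _; rewrite /= lee_fin normr1 ler_norml cos_geN1 cos_le1.
move=> cE; under eq_integral do rewrite EFinB.
rewrite integralB_EFin//; last exact: finite_measure_integrable_cst.
rewrite integral_cst// [X in (_ * X - _)%E](_ : _ = 1%E); last exact: probability_setT.
rewrite mule1 -[X in (_ - X)%E]fineK; last exact: integrable_fin_num.
rewrite cE -EFinB lee_fin.
have := expR_ge1Dx (- J); lra.
Qed.

Theorem proposition8 (R : realType) (a b H lambda : R)
    (ha : 0 < a) (hab : a <= b) (hb : b <= 2)
    (hH0 : 0 < H) (hH1 : H < 1) (hlambda : 0 < lambda) :
  exists C1 : R,
    forall (alpha : R -> R),
      continuous alpha -> (forall x, a <= alpha x <= b) ->
    forall (d : measure_display) (T : measurableType d) (P : probability T R)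
      (X : R -> {RV P >-> R}),
      is_ltfmsm H alpha lambda X ->
    forall p : R, 0 < p < a ->
    forall t v : R, 1 <= `|t - v| ->
      ('E_P[fun w => (`|X t w - X v w| `^ p)%R]
       <= (C1 * (1 + p / (a - p)) * `|t - v| `^ (H * b))%:E)%E.
Proof.
have [K K0 hK] := integral_tkernel_bound a H lambda hH0 hH1 hlambda ha.
have K40 : 0 <= 4 * (K + K) by rewrite mulr_ge0// addr_ge0.
(* The constant of [powR_moment_le] with [C = 4 * (K + K)], the bound for the increment kernel. *)
exists ((1 + 4 / (1 - cos 1) * (4 * (K + K))) * (1 + (a * ln 2)^-1)).
move=> alpha ca hal d T P X [I [hI XI]] p pa t v tv.
have hal2 x : a <= alpha x <= 2.
  by have /andP[-> h] := hal x; exact: le_trans hb.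
have hf s := tkernelB_integrand _ K H alpha lambda s 0 ca ha hal2
  (fun s => hK alpha s ca hal2).
have hG s : multistable_integrand alpha (G_ltfmsm H alpha lambda s).
  have [m i] := hf s; rewrite G_ltfmsmE; split => //.
  by apply: le_lt_trans i _; rewrite ltry.
pose Y w := I (G_ltfmsm H alpha lambda t) w - I (G_ltfmsm H alpha lambda v) w.
have mY : measurable_fun setT Y by exact: measurable_funB.
have mE (Z : T -> R) : measurable_fun setT Z ->
    measurable_fun setT (fun w => (`|Z w| `^ p)%:E).
  move=> mZ; apply/measurable_EFinP; apply: measurable_fun_powR2 => //.
  exact: measurableT_comp.
(* [X t] and [X v] agree with their integrals only almost surely, which suffices under the
   expectation. *)
rewrite unlock (@ae_eq_integral _ _ _ _ _ (fun w => (`|Y w| `^ p)%:E))//.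
- apply: (@le_trans _ _ _ _ _ (powR_moment_le _ P Y a p (4 * (K + K)) mY pa _ K40 _)).
  + exact: le_trans hb.
  + move=> theta hth; apply: (multistable_integral_cos_le _ P alpha I _ _ _ _ _
      hI _ _ (hG t) (hG v) _ hth).
    * exact: continuous_measurable_fun.
    * by move=> x; have /andP[] := hal x.
    * rewrite !G_ltfmsmE.
      have [_ i] := tkernelB_integrand _ K H alpha lambda t v ca ha hal2
        (fun s => hK alpha s ca hal2).
      (* The kernels at time 0 cancel in the difference. *)
      by under eq_integral do rewrite opprB addrA subrK.
  + have /andP[p0 pa'] := pa.
    rewrite lee_fin ler_peMr//; last first.
      by rewrite -(powRr0 `|t - v|) ler_powR// mulr_ge0 ?(ltW hH0)// (le_trans (ltW ha)).
    have D0 : 0 <= 4 / (1 - cos 1) :> R by rewrite divr_ge0 ?subr_ge0 ?cos_le1.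
    have L0 : 0 <= (a * ln 2)^-1.
      by rewrite invr_ge0 mulr_ge0 ?ln_ge0 ?ler1n ?(ltW ha).
    have p1 : 0 <= p / (a - p) by rewrite divr_ge0 ?subr_ge0 ?(ltW p0) ?(ltW pa').
    by apply: mulr_ge0; [apply: mulr_ge0|]; apply: addr_ge0 => //; apply: mulr_ge0.
- by apply: mE; exact: measurable_funB.
- exact: mE.
- have hXt := XI t; have hXv := XI v.
  by move: hXt hXv; apply: filterS2 => w /= e1 e2 _; rewrite e1 e2.
Qed.
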